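(* Let $G=(X\cup Y,E)$ be the complement of a bipartite chain graph. Then $\Gamma(G)=Tr(G)$.
   Context: All graphs are finite and simple. For disjoint $A,B\subseteq V$, $A$ dominates $B$ if every vertex of $B$ is adjacent to at least one vertex of $A$. A transitive $k$-partition of $G=(V,E)$ is a partition $\{V_1,\dots,V_k\}$ of $V$ into $k$ nonempty parts such that $V_i$ dominates $V_j$ for all $1\le i<j\le k$; the transitivity $Tr(G)$ is the maximum such $k$. A Grundy partition is a transitive partition in which every part is an independent set; the Grundy number $\Gamma(G)$ is the maximum order of a Grundy partition. A bipartite graph $H=(X\cup Y,E)$ is a bipartite chain graph if there are orderings $x_1,\dots,x_{n_1}$ of $X$ and $y_1,\dots,y_{n_2}$ of $Y$ with $N(x_{n_1})\subseteq\cdots\subseteq N(x_1)$ and $N(y_{n_2})\subseteq\cdots\subseteq N(y_1)$. ''$G$ is the complement of a bipartite chain graph'' means $\overline{G}$ is a bipartite chain graph with bipartition $X,Y$. *)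

(* Defs.v *)
From mathcomp Require Import all_boot.

Set Implicit Arguments.
Unset Strict Implicit.
Unset Printing Implicit Defensive.

Record sgraph := SGraph {
  vertex :> finType;
  adj : rel vertex;
  adj_sym : symmetric adj;
  adj_irr : irreflexive adj }.

Definition nbhd (G : sgraph) (x : G) : {set G} := [set y | adj x y].

Definition compl_adj (G : sgraph) : rel G := [rel x y | (x != y) && ~~ adj x y].

Lemma compl_adj_sym (G : sgraph) : symmetric (@compl_adj G).
Proof. by move=> x y; rewrite /compl_adj /= eq_sym adj_sym. Qed.

Lemma compl_adj_irr (G : sgraph) : irreflexive (@compl_adj G).
Proof. by move=> x; rewrite /compl_adj /= eqxx. Qed.

Definition compl (G : sgraph) : sgraph :=
  SGraph (@compl_adj_sym G) (@compl_adj_irr G).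

Definition independent (G : sgraph) (A : {set G}) : bool :=
  [forall x in A, forall y in A, ~~ adj x y].

Definition dominates (G : sgraph) (A B : {set G}) : bool :=
  [forall y in B, exists x in A, adj x y].

(* The order of the tuple is the order V_1, ..., V_k used by the domination
   condition; [uniq P] makes the number of parts exactly k, and
   [partition] includes nonemptiness of the parts. *)
Definition transitive_partition (G : sgraph) (k : nat)
    (P : k.-tuple {set G}) : bool :=
  [&& uniq P, partition [set A in P] [set: G] &
      [forall i : 'I_k, forall j : 'I_k,
         (i < j) ==> dominates (tnth P i) (tnth P j)]].

Definition grundy_partition (G : sgraph) (k : nat)
    (P : k.-tuple {set G}) : bool :=
  transitive_partition P && [forall i : 'I_k, independent (tnth P i)].

Lemma transitive_partition_order (G : sgraph) (k : nat)
    (P : k.-tuple {set G}) : transitive_partition P -> k <= #|G|.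
Proof.
case/and3P => uniqP partP _; rewrite -cardsT (card_partition partP).
have cardP : #|[set A in P]| = k.
  by rewrite cardsE (card_uniqP uniqP) size_tuple.
apply: (@leq_trans #|[set A in P]|); first by rewrite cardP.
rewrite -sum1_card; apply: leq_sum => A A_P.
rewrite card_gt0; apply: contraTneq A_P => ->.
by case/and3P: partP.
Qed.

(* Restricting the maximum to k <= #|G| loses nothing, by
   [transitive_partition_order]. *)
Definition transitivity (G : sgraph) : nat :=
  \max_(k < #|G|.+1 |
        [exists P : k.-tuple {set G}, transitive_partition P]) k.

Definition grundy_number (G : sgraph) : nat :=
  \max_(k < #|G|.+1 |
        [exists P : k.-tuple {set G}, grundy_partition P]) k.

(* [s] is an ordering s_1, s_2, ... of the elements of A with
   ... \subset N(s_2) \subset N(s_1). *)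
Definition chain_ordering (G : sgraph) (A : {set G}) (s : seq G) : bool :=
  perm_eq s (enum A) && sorted [rel u v | nbhd v \subset nbhd u] s.

(* Either side of the bipartition may be empty. *)
Definition bipartite_chain (H : sgraph) (X Y : {set H}) : Prop :=
  [/\ X :|: Y = [set: H], [disjoint X & Y],
      independent X, independent Y &
      exists xs ys : seq H, chain_ordering X xs /\ chain_ordering Y ys].

(* Main.v *)
(** Let H be the complement of G, with chain orderings x_1, x_2, ... and
    y_1, y_2, ... of its two sides, and let r be the largest index such that
    x_i and y_i are H-adjacent for all i <= r.
    - The pairs {x_i, y_i}, i <= r, followed by all other vertices as
      singletons, form a Grundy partition of order n - r: X and Y are cliques of
      G, so each pair dominates everything, and the chain property makes the
      remaining vertices a clique of G.
    - The sets A = {x_1, ..., x_r} and B = {y_1, ..., y_r} are joined by no edge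
      of G, so a transitive partition cannot have both a part inside A and a
      part inside B. If no part lies inside A, say, then every part contains a
      vertex outside A, and there are at most n - r parts. *)
Require Import Defs.
From mathcomp Require Import all_boot.
From mathcomp Require Import zify.

Set Implicit Arguments.
Unset Strict Implicit.
Unset Printing Implicit Defensive.

(** * Upper bounds on the order of a transitive partition *)

Lemma transitive_partition_inj (G : sgraph) (k : nat) (P : k.-tuple {set G})
    (i j : 'I_k) (v : G) :
  transitive_partition P -> v \in tnth P i -> v \in tnth P j -> i = j.
Proof.
case/and3P=> uniqP /and3P[_ /trivIsetP trivP _] _ vi vj.
have neq : tnth P i = tnth P j.
  apply/eqP/negPn/negP => nij.
  have := trivP (tnth P i) (tnth P j).
  rewrite !inE !mem_tnth => /(_ isT isT nij) /pred0P /(_ v) /=.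
  by rewrite vi vj.
by move/tuple_uniqP: uniqP; apply.
Qed.

Lemma transitive_partition_neq0 (G : sgraph) (k : nat) (P : k.-tuple {set G})
    (i : 'I_k) : transitive_partition P -> exists v, v \in tnth P i.
Proof.
case/and3P=> _ /and3P[_ _ nP0] _; apply/set0Pn; apply: contraNneq nP0 => <-.
by rewrite inE mem_tnth.
Qed.

(** Each part supplies a vertex outside [A], and disjointness of the parts makes this choice
    injective. *)
Lemma transitive_partition_order_setC (G : sgraph) (k : nat)
    (P : k.-tuple {set G}) (A : {set G}) :
  transitive_partition P -> (forall i, ~~ (tnth P i \subset A)) ->
  k + #|A| <= #|G|.
Proof.
move=> tP nsub; rewrite -(cardsC A) addnC leq_add2l.
have /fin_all_exists[f fP] : forall i : 'I_k, exists v, v \in tnth P i :\: A.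
  by move=> i; have /subsetPn[v vi vA] := nsub i; exists v; rewrite !inE vA.
have injf : injective f.
  move=> i j eqf; move: (fP i) (fP j); rewrite eqf !inE.
  move=> /andP[_ vi] /andP[_ vj]; exact: transitive_partition_inj tP vi vj.
rewrite -[k in k <= _]card_ord -(card_codom injf); apply: subset_leq_card.
by apply/subsetP => _ /codomP[i ->]; have := fP i; rewrite !inE => /andP[].
Qed.

(** A part inside [A] and a part inside [B] are distinct, since a nonempty part cannot lie in both;
    the earlier would then dominate the later through an edge between [A] and [B]. So one of the two
    sets contains no part. *)
Lemma transitive_partition_order_anticomplete (G : sgraph) (k : nat)
    (P : k.-tuple {set G}) (A B : {set G}) :
  transitive_partition P -> [disjoint A & B] ->
  (forall a b, a \in A -> b \in B -> ~~ adj a b) ->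
  k + minn #|A| #|B| <= #|G|.
Proof.
move=> tP dAB nadj.
case: (boolP [forall i, ~~ (tnth P i \subset A)]) => [/forallP nA | ].
  have := transitive_partition_order_setC tP nA; lia.
rewrite negb_forall => /existsP[i /negPn iA].
suff nB : forall j, ~~ (tnth P j \subset B).
  have := transitive_partition_order_setC tP nB; lia.
move=> j; apply/negP => jB.
have [u ui] := transitive_partition_neq0 i tP.
have [v vj] := transitive_partition_neq0 j tP.
have uA := subsetP iA u ui; have vB := subsetP jB v vj.
have dom (l m : 'I_k) w : l < m -> w \in tnth P m ->
    exists2 z, z \in tnth P l & adj z w.
  case/and3P: tP => _ _ /forallP /(_ l) /forallP /(_ m) /implyP dP lm wm.
  by have /forallP /(_ w) /implyP /(_ wm) /exists_inP := dP lm.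
case: (ltngtP i j) => [ij | ji | /val_inj eij].
- have [z zi] := dom _ _ _ ij vj.
  by apply/negP/nadj => //; apply: (subsetP iA).
- have [z zj] := dom _ _ _ ji ui; rewrite adj_sym.
  by apply/negP/nadj => //; apply: (subsetP jB).
- have uB : u \in B by apply: (subsetP jB); rewrite -eij.
  by have /pred0P /(_ u) /= := dAB; rewrite uA uB.
Qed.

(** * Greedy colourings and bounds for the two parameters *)

(** Lets a Grundy partition be given as a greedy colouring. Surjectivity makes the classes nonempty,
    hence also pairwise distinct; the last hypothesis is domination. *)
Lemma grundy_partition_of_coloring (G : sgraph) (k : nat) (c : G -> nat) :
  (forall v, c v < k) -> (forall i, i < k -> exists v, c v = i) ->
  (forall u v, adj u v -> c u != c v) ->
  (forall u i, i < c u -> exists2 v, c v = i & adj v u) ->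
  grundy_partition [tuple [set v | c v == i] | i < k].
Proof.
move=> ck surj proper greedy.
apply/andP; split; last first.
  apply/forallP => i; rewrite tnth_mktuple.
  apply/forall_inP => u; rewrite inE => /eqP cu.
  apply/forall_inP => v; rewrite inE => /eqP cv.
  by apply/negP => /proper; rewrite cu cv eqxx.
apply/and3P; split.
- apply/tuple_uniqP => i j; rewrite !tnth_mktuple => /setP eqij.
  have [v cv] := surj i (ltn_ord i).
  by have := eqij v; rewrite !inE cv eqxx => /esym /eqP /val_inj.
- apply/and3P; split.
  + apply/eqP/setP => v; rewrite [RHS]inE; apply/bigcupP.
    exists [set w | c w == Ordinal (ck v)]; last by rewrite inE.
    rewrite inE; apply/tnthP; exists (Ordinal (ck v)).
    by rewrite tnth_mktuple.
  + apply/trivIsetP => A B; rewrite !inE.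
    move=> /tnthP[i ->] /tnthP[j ->]; rewrite !tnth_mktuple => nij.
    apply/pred0P => v /=; rewrite !inE; apply: contraNF nij.
    by move=> /andP[/eqP <- /eqP <-].
  + rewrite inE; apply/negP => /tnthP[i]; rewrite tnth_mktuple => /setP e0.
    have [v cv] := surj i (ltn_ord i).
    by have := e0 v; rewrite !inE cv eqxx.
- apply/forallP => i; apply/forallP => j; apply/implyP => ij.
  rewrite !tnth_mktuple; apply/forall_inP => u; rewrite inE => /eqP cu.
  have [v cv vu] : exists2 v, c v = i & adj v u by apply: greedy; rewrite cu.
  by apply/exists_inP; exists v => //; rewrite inE cv.
Qed.

Lemma grundy_number_ge (G : sgraph) (k : nat) (P : k.-tuple {set G}) :
  grundy_partition P -> k <= grundy_number G.
Proof.
move=> gP; have kG : k < #|G|.+1.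
  by case/andP: gP => /transitive_partition_order.
apply: (@leq_bigmax_cond _ _ (fun i : 'I_#|G|.+1 => i : nat) (Ordinal kG)).
by apply/existsP; exists P.
Qed.

Lemma transitivity_le (G : sgraph) (m : nat) :
  (forall k (P : k.-tuple {set G}), transitive_partition P -> k <= m) ->
  transitivity G <= m.
Proof. by move=> le_m; apply/bigmax_leqP => k /existsP[P /le_m]. Qed.

Lemma grundy_number_le_transitivity (G : sgraph) :
  grundy_number G <= transitivity G.
Proof.
apply/bigmax_leqP => k /existsP[P /andP[tP _]].
apply: (@leq_bigmax_cond _ _ (fun i : 'I_#|G|.+1 => i : nat) k).
by apply/existsP; exists P.
Qed.

(** * Chain orderings and positions in a sequence *)

Lemma chain_ordering_nbhd (H : sgraph) (A : {set H}) (s : seq H) (u v w : H) :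
  chain_ordering A s -> v \in A -> index u s <= index v s ->
  adj v w -> adj u w.
Proof.
case/andP=> /perm_mem memA sorteds vA uv vw.
have vs : v \in s by rewrite memA mem_enum.
have lev : index v s < size s by rewrite index_mem.
(* An absent element has index [size s], so the bound on [index u s] already forces membership. *)
have us : u \in s by rewrite -index_mem (leq_ltn_trans uv).
have trans : transitive [rel u v : H | nbhd v \subset nbhd u].
  by move=> a b c /= ba cb; apply: subset_trans cb ba.
have refl : reflexive [rel u v : H | nbhd v \subset nbhd u].
  by move=> a /=.
have := sorted_leq_nth trans refl u sorteds.
move=> /(_ (index u s) (index v s)); rewrite !inE !index_mem.
move=> /(_ us vs uv); rewrite !nth_index //= => /subsetP /(_ w).
by rewrite !inE; apply.
Qed.

Lemma index_surj (T : eqType) (s : seq T) (i : nat) :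
  uniq s -> i < size s -> exists2 x, x \in s & index x s = i.
Proof.
case: s => [//|x0 s] us lt_i; exists (nth x0 (x0 :: s) i).
  exact: mem_nth.
exact: index_uniq.
Qed.

Lemma card_index_lt (T : finType) (s : seq T) (r : nat) :
  uniq s -> r <= size s -> #|[set x in s | index x s < r]| = r.
Proof.
move=> us le_r; rewrite -[RHS](size_takel le_r).
rewrite -(card_uniqP (take_uniq r us)); apply: eq_card => x; rewrite inE.
case: (boolP (x \in s)) => xs /=; first by rewrite in_take.
by apply/esym; apply: contraNF xs; apply: mem_take.
Qed.

(** * The equality for two cliques ordered by position *)

(** The theorem phrased inside [G]: the chain condition of the complement becomes inheritance of
    nonadjacency by earlier positions. *)
Lemma grundy_number_eq_transitivity_of_ranks (G : sgraph) (xs ys : seq G) :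
  uniq xs -> uniq ys -> (forall v, (v \in ys) = (v \notin xs)) ->
  {in xs &, forall u v, u != v -> adj u v} ->
  {in ys &, forall u v, u != v -> adj u v} ->
  (forall u v w, u \in xs -> v \in xs -> w \in ys ->
     index u xs <= index v xs -> ~~ adj v w -> ~~ adj u w) ->
  (forall u v w, u \in ys -> v \in ys -> w \in xs ->
     index u ys <= index v ys -> ~~ adj v w -> ~~ adj u w) ->
  grundy_number G = transitivity G.
Proof.
move=> uxs uys ysE cliqueX cliqueY monoX monoY.
have cardG : #|G| = size xs + size ys.
  rewrite -(cardC (mem xs)) (card_uniqP uxs) -(card_uniqP uys).
  by congr (_ + _); apply: eq_card => v; rewrite !inE ysE.
(* Since it asks for actual elements at position [i], [paired i] fails once either list is
   exhausted; hence [size xs] bounds the search for the least failing index [r]. *)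
pose paired (i : nat) := [exists x in xs, exists y in ys,
  [&& index x xs == i, index y ys == i & ~~ adj x y]].
have pairedP (i : nat) : paired i -> exists x y,
    [/\ x \in xs, y \in ys, index x xs = i, index y ys = i & ~~ adj x y].
  by case/exists_inP=> x xX /exists_inP[y yY /and3P[/eqP ? /eqP ? ?]]; exists x, y.
have [r nr rmin] : exists2 r : nat, ~~ paired r & forall i, i < r -> paired i.
  have ex : exists i : nat, ~~ paired i.
    exists (size xs); apply/negP => /pairedP[x [y [xX _ ix _ _]]].
    by move: xX; rewrite -index_mem ix ltnn.
  case: (ex_minnP ex) => r nr rmin; exists r => // i.
  by apply: contraTT => /rmin; rewrite leqNgt.
have [rX rY] : r <= size xs /\ r <= size ys.
  case: r {nr} rmin => // r /(_ r (ltnSn r)) /pairedP[x [y [xX yY ix iy _]]].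
  by rewrite -{1}ix -iy !index_mem.
(* The pair at the larger of the two positions is nonadjacent; monotonicity moves its other endpoint
   down. *)
have low x y : x \in xs -> y \in ys -> index x xs < r -> index y ys < r ->
    ~~ adj x y.
  move=> xX yY xr yr; case: (leqP (index x xs) (index y ys)) => [xy | /ltnW yx].
    have [x' [y' [x'X y'Y ix' iy' nadj]]] := pairedP _ (rmin _ yr).
    have ey : y' = y by apply: (@index_inj _ y' ys).
    by rewrite ey in nadj; apply: monoX nadj; rewrite ?ix'.
  have [x' [y' [x'X y'Y ix' iy' nadj]]] := pairedP _ (rmin _ xr).
  have ex : x' = x by apply: (@index_inj _ x' xs).
  rewrite ex adj_sym in nadj; rewrite adj_sym.
  by apply: monoY nadj; rewrite ?iy'.
(* A nonadjacent pair here could be moved down to position [r] on both sides, making [r] paired. *)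
have high x y : x \in xs -> y \in ys -> r <= index x xs -> r <= index y ys ->
    adj x y.
  move=> xX yY rx ry; apply: contraNT nr => nadj.
  have [x' x'X ix'] : exists2 x', x' \in xs & index x' xs = r.
    by apply: index_surj => //; apply: leq_ltn_trans rx _; rewrite index_mem.
  have [y' y'Y iy'] : exists2 y', y' \in ys & index y' ys = r.
    by apply: index_surj => //; apply: leq_ltn_trans ry _; rewrite index_mem.
  apply/exists_inP; exists x' => //; apply/exists_inP; exists y' => //.
  rewrite ix' iy' !eqxx /= adj_sym; apply: (monoY _ y) => //.
    by rewrite iy'.
  by rewrite adj_sym; apply: (monoX _ x); rewrite ?ix'.
apply/eqP; rewrite eqn_leq grundy_number_le_transitivity /=.
(* This value bounds every transitive partition and is attained by a Grundy partition. *)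
apply: (@leq_trans (#|G| - r)).
  apply: transitivity_le => k P tP.
  pose A := [set x in xs | index x xs < r].
  pose B := [set y in ys | index y ys < r].
  have : k + minn #|A| #|B| <= #|G|.
    apply: transitive_partition_order_anticomplete tP _ _.
      apply/pred0P => v /=; rewrite !inE ysE.
      by case: (v \in xs); rewrite ?andbF.
    by move=> a b; rewrite !inE => /andP[aX ar] /andP[bY br]; apply: low.
  rewrite !card_index_lt // minnn; lia.
(* Class i is {x_i, y_i} for i < r, {x_i} for r <= i < |X|, and the remaining
   y's get the colours from |X| on. *)
pose c v := if v \in xs then index v xs else
            if index v ys < r then index v ys else index v ys + (size xs - r).
have cX v : v \in xs -> c v = index v xs by rewrite /c => ->.
have cY v : v \in ys -> c v =
    if index v ys < r then index v ys else index v ys + (size xs - r).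
  by rewrite /c ysE => /negbTE ->.
have side v : (v \in xs /\ index v xs < size xs) \/
    (v \in ys /\ index v ys < size ys).
  by rewrite !index_mem ysE; case: (v \in xs); [left | right].
have surjX i : i < size xs -> exists v, v \in xs /\ c v = i.
  by move=> /(index_surj uxs)[v vX iv]; exists v; rewrite cX.
have surjY i : i < r -> exists v, v \in ys /\ c v = i.
  move=> ir; have /(index_surj uys)[v vY iv] := leq_trans ir rY.
  by exists v; rewrite cY // iv ir.
have surjY' i : size xs <= i < #|G| - r -> exists v, v \in ys /\ c v = i.
  move=> irange; have : i - (size xs - r) < size ys by lia.
  move=> /(index_surj uys)[v vY iv]; exists v; split=> //; rewrite cY // iv.
  by case: ifP; lia.
apply: grundy_number_ge (@grundy_partition_of_coloring G (#|G| - r) c _ _ _ _).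
- move=> v; case: (side v) => [[vX lt_v] | [vY lt_v]].
    by rewrite cX //; lia.
  by rewrite cY //; case: ifP; lia.
- move=> i ik; case: (ltnP i (size xs)) => iX.
    by have [v [_ cv]] := surjX i iX; exists v.
  by have [|v [_ cv]] := surjY' i; [rewrite iX | exists v].
(* A colour shared across the two sides is below [r], where [low] excludes adjacency. *)
- have XY u v : u \in xs -> v \in ys -> adj u v -> c u != c v.
    move=> uX vY uv; rewrite cX // cY //; have uXs : index u xs < size xs.
      by rewrite index_mem.
    case: ifP => [vr | ]; last by lia.
    case: (ltnP (index u xs) r) => ur; last by lia.
    by rewrite (negbTE (low u v uX vY ur vr)) in uv.
  move=> u v uv; have nuv : u != v by apply: contraTneq uv => ->; rewrite adj_irr.
  case: (side u) (side v) => [[uX _] | [uY _]] [[vX _] | [vY _]].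
  + by apply: contra_neq nuv; rewrite !cX //; apply: index_inj.
  + exact: XY.
  + by rewrite eq_sym; apply: XY => //; rewrite adj_sym.
  + apply: contra_neq nuv; rewrite !cY // => cuv.
    apply: (@index_inj _ u ys) => //; move: cuv.
    by case: ifP; case: ifP; lia.
- move=> u i iu; have neq v : c v = i -> v != u.
    by move=> cv; apply: contraTneq iu => <-; rewrite cv ltnn.
  case: (side u) => [[uX lt_u] | [uY lt_u]].
    have [|v [vX cv]] := surjX i; first by rewrite cX // in iu; lia.
    by exists v => //; apply: cliqueX => //; apply: neq.
  case: (ltnP i r) => ir.
    have [v [vY cv]] := surjY i ir.
    by exists v => //; apply: cliqueY => //; apply: neq.
  (* Colours in [[r, size xs)] occur only in [xs], so the neighbour comes from the other clique;
     [r <= i < c u] puts [u] at position at least [r], so [high] applies. *)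
  case: (ltnP i (size xs)) => iX.
    have [v [vX cv]] := surjX i iX; exists v => //; apply: high => //.
      by rewrite -cX // cv.
    by move: iu; rewrite cY //; case: ifP; lia.
  have [|v [vY cv]] := surjY' i.
    by move: iu; rewrite iX andTb cY //; case: ifP; lia.
  by exists v => //; apply: cliqueY => //; apply: neq.
Qed.

(** * Translation from the complement back to [G] *)

Lemma chain_ordering_compl (G : sgraph) (A B : {set G}) (s : seq G) (u v w : G) :
  @chain_ordering (compl G) A s -> [disjoint A & B] -> v \in A ->
  w \in B -> index u s <= index v s -> ~~ adj v w -> ~~ adj u w.
Proof.
move=> chA dAB vA wB uv nvw.
(* Nonadjacency in [G] gives an edge of the complement only between distinct vertices. *)
have nvw' : v != w.
  by apply: contraTneq wB => <-; rewrite (disjointFr dAB vA).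
have adj_vw : @adj (compl G) v w by apply/andP.
by case/andP: (chain_ordering_nbhd chA vA uv adj_vw).
Qed.

Lemma independent_compl (G : sgraph) (A : {set G}) :
  @independent (compl G) A -> {in A &, forall u v, u != v -> adj u v}.
Proof.
move=> /forall_inP iA u v uA vA nuv.
have /forall_inP /(_ v vA) := iA u uA.
by apply: contraNT => nadj; apply/andP.
Qed.

Theorem theorem2 (G : sgraph) (X Y : {set G}) :
  @bipartite_chain (compl G) X Y -> grundy_number G = transitivity G.
Proof.
case=> XY dXY iX iY [xs [ys [chX chY]]].
have /andP[pX _] := chX; have /andP[pY _] := chY.
have xsE (v : G) : (v \in (xs : seq G)) = (v \in X).
  by rewrite (perm_mem pX) mem_enum.
have ysE (v : G) : (v \in (ys : seq G)) = (v \in Y).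
  by rewrite (perm_mem pY) mem_enum.
have dYX : [disjoint Y & X] by rewrite disjoint_sym.
apply: (@grundy_number_eq_transitivity_of_ranks G xs ys).
- by rewrite (perm_uniq pX) enum_uniq.
- by rewrite (perm_uniq pY) enum_uniq.
- move=> v; rewrite ysE xsE; have := in_setT v; rewrite -[setT]XY inE.
  by case vX: (v \in X) => //= _; rewrite (disjointFr dXY vX).
- by move=> u v; rewrite !xsE; apply: independent_compl.
- by move=> u v; rewrite !ysE; apply: independent_compl.
- by move=> u v w _; rewrite xsE ysE; apply: chain_ordering_compl chX dXY.
- by move=> u v w _; rewrite xsE ysE; apply: chain_ordering_compl chY dYX.
Qed.
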